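(* For any real $\alpha$ with $0<\alpha<4$, no strictly monotone deterministic online algorithm for maximizing a non-negative monotone submodular function under a partition matroid constraint with free disposal, on instances of the form described in the context (all parts of capacity $1$), can have competitive ratio strictly larger than $\frac1\alpha$.
   Context: Instances: let $\mathcal{U}$ be a universe of items with weights $\nu:\mathcal{U}\to\mathbb{R}_+$, and $\nu(X):=\sum_{x\in X}\nu(x)$ for $X\subseteq\mathcal{U}$. For $i\ge0$ let $\Omega_i:=\{(u,i):u\in\mathcal{U}\}$ and let $\Omega:=\bigcup_{i\ge0}\Omega_i$. A (finite) set $S\subset\Omega$ is independent iff $|S\cap\Omega_i|\le1$ for all $i$ (a partition matroid with unit capacities). The objective is $f(S):=\nu(\{x:(x,i)\in S\text{ for some }i\})$, which is monotone submodular. Online problem with free disposal: distinct elements of $\Omega$ arrive one by one in a finite sequence whose length is unknown to the algorithm. The algorithm maintains an independent set $S$, initially empty. When $u$ arrives, it may remove elements from $S$ and may include $u$ in $S$, as long as $S$ remains independent; rejected or removed elements cannot be retrieved. The algorithm has a value oracle for $f$ and an independence oracle, only on sets of elements that have arrived so far, so the decisions of a deterministic algorithm are determined by this information. $\mathsf{OPT}$ is an independent set of elements of the sequence maximizing $f$. A deterministic algorithm has competitive ratio $r$ if for every instance and at the end of every finite sequence, $f(S)\ge r\cdot f(\mathsf{OPT})$. Strict monotonicity: an algorithm is strictly monotone if, in each round, it includes the new arriving element into $S$ (possibly removing some elements from $S$) only if the objective value $f(S)$ strictly increases compared to its value at the beginning of the round. *)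

(* Defs.v *)
From HB Require Import structures.
From mathcomp Require Import all_boot all_order all_algebra finmap.
From mathcomp Require Import boolp reals.

Set Implicit Arguments.
Unset Strict Implicit.
Unset Printing Implicit Defensive.

Import Order.TTheory GRing.Theory Num.Theory.
Local Open Scope fset_scope.
Local Open Scope ring_scope.

Record instance (R : realType) := Instance {
  universe : choiceType;
  weight : universe -> R;
  weight_ge0 : forall x, 0 <= weight x
}.

(* [(u, i)] is the copy of the item [u] lying in the part [Omega_i]. *)
Definition Omega (R : realType) (I : instance R) : choiceType :=
  (universe I * nat)%type.

Definition independent (R : realType) (I : instance R) (S : {fset Omega I}) :=
  forall i : nat, (#|` [fset z in S | z.2 == i]| <= 1)%N.

(* The items are collected in a set before summing, so that an item with
   several copies in [S] is counted once. *)
Definition objective (R : realType) (I : instance R) (S : {fset Omega I}) : R :=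
  \sum_(x <- [fset z.1 | z in S]) weight x.

(* Arrived elements are handled through their arrival positions. *)
Definition elements (R : realType) (I : instance R) (s : seq (Omega I))
    (P : {set 'I_(size s)}) : {fset Omega I} :=
  [fset tnth (in_tuple s) k | k in P].

Definition value_oracle (R : realType) (I : instance R) (s : seq (Omega I)) :
    {ffun {set 'I_(size s)} -> R} :=
  [ffun P => objective (elements P)].

Definition independence_oracle (R : realType) (I : instance R)
    (s : seq (Omega I)) : {ffun {set 'I_(size s)} -> bool} :=
  [ffun P : {set 'I_(size s)} => `[< independent (elements P) >]].

(* A deterministic rule mapping the number [n] of arrived elements and the
   answers of both oracles on all sets of arrived elements to the set of
   positions of the elements held after round [n].  The answers available in
   earlier rounds, hence all earlier decisions, are determined by these data. *)
Definition rule (R : realType) :=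
  forall n : nat, {ffun {set 'I_n} -> R} -> {ffun {set 'I_n} -> bool} ->
  {set 'I_n}.

Definition solution (R : realType) (A : rule R) (I : instance R)
    (s : seq (Omega I)) : {fset Omega I} :=
  elements (A (size s) (value_oracle s) (independence_oracle s)).

(* The initial solution [solution A [::]] is empty, since ['I_0] is. *)
Definition online_algorithm (R : realType) (A : rule R) :=
  forall I : instance R,
    (forall s : seq (Omega I), uniq s -> independent (solution A s)) /\
    (forall (s : seq (Omega I)) (u : Omega I), uniq (rcons s u) ->
       solution A (rcons s u) `<=` u |` solution A s).

Definition strictly_monotone (R : realType) (A : rule R) :=
  forall (I : instance R) (s : seq (Omega I)) (u : Omega I),
    uniq (rcons s u) -> u \in solution A (rcons s u) ->
    objective (solution A s) < objective (solution A (rcons s u)).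

Definition is_opt (R : realType) (I : instance R) (s : seq (Omega I))
    (O : {fset Omega I}) :=
  [/\ independent O, O `<=` [fset z in s] &
      forall T : {fset Omega I}, independent T -> T `<=` [fset z in s] ->
        objective T <= objective O].

Definition competitive (R : realType) (A : rule R) (r : R) :=
  forall (I : instance R) (s : seq (Omega I)) (O : {fset Omega I}),
    uniq s -> is_opt s O -> r * objective O <= objective (solution A s).

(* Main.v *)
(** All decisive items compete for part 0.  Item [k] first arrives in part 0 and,
    once it is held there, arrives again in the fresh part [k.+1]; strict
    monotonicity forces the algorithm to reject this copy, so it never holds more
    than one item, while the optimum collects all of them.  The weights are chosen
    with [\sum_(k < n.+2) w k = alpha * w n], so an algorithm of ratio larger than
    [alpha^-1] must exchange item [n] for item [n.+1].  This amounts to the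
    recurrence [w n.+2 = alpha * (w n.+1 - w n)], whose characteristic polynomial
    has no real root when [alpha < 4]; hence some weight is nonpositive, and
    stopping just before the first such weight beats the algorithm. *)

Require Import Defs.
From mathcomp Require Import all_boot all_order all_algebra finmap.
From mathcomp Require Import boolp reals.
From mathcomp Require Import ring lra.

Import Order.TTheory GRing.Theory Num.Theory.
Local Open Scope ring_scope.

(** * Independent sets, optima and objective values *)

Section Generalities.
Local Open Scope fset_scope.
Context {R : realType} {I : instance R}.
Implicit Types (s : seq (Omega I)) (T : {fset Omega I}) (A : rule R).

Lemma independentP T :
  independent T <-> {in T &, injective (fun z : Omega I => z.2)}.
Proof.
split=> [indT z t zT tT eq_zt|injT i].
  have := indT z.2; rewrite leq_eqVlt ltnS leqn0 => /orP[|].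
    move=> /cardfs1P[x Tx].
    have : z \in [fset x] by rewrite -Tx !inE zT /=.
    have : t \in [fset x] by rewrite -Tx !inE tT /= -eq_zt.
    by rewrite !inE => /eqP-> /eqP->.
  rewrite cardfs_eq0 => /eqP/fsetP/(_ z).
  by rewrite !inE zT eqxx.
set Ti := [fset z in T | z.2 == i].
have [->|/fset0Pn[x xTi]] := eqVneq Ti fset0; first by rewrite cardfs0.
rewrite -(cardfs1 x); apply/fsubset_leq_card/fsubsetP => z.
move: xTi; rewrite !inE => /andP[xT /eqP xi] /andP[zT /eqP zi].
by apply/eqP/injT => //; rewrite zi xi.
Qed.

Lemma is_opt_ex s : exists O, is_opt s O.
Proof.
pose X := [fset z in s]; pose P := fun T => `[< independent T >].
have X0 : fset0 \in fpowerset X by rewrite fpowersetE fsub0set.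
pose x0 : fpowerset X := [` X0].
have Px0 : P (val x0) by apply/asboolP/independentP => z.
pose O := [arg max_(T > x0 | P (val T)) objective (val T)]%O.
exists (val O); rewrite /O; case: arg_maxP => //= T /asboolP indT maxT.
split=> //; first by rewrite -fpowersetE (valP T).
move=> T' indT'; rewrite -fpowersetE => XT'.
by apply: (maxT [` XT']); apply/asboolP.
Qed.

(** An optimum exists, as there are finitely many independent sets of arrived elements, and it
    dominates [T]. *)
Lemma competitive_independent A r s T : 0 <= r -> competitive A r -> uniq s ->
  independent T -> {subset T <= s} ->
  r * objective T <= objective (solution A s).
Proof.
move=> r0 compA us indT Ts; have [O optO] := is_opt_ex s.
apply: le_trans (compA I s O us optO); apply: ler_wpM2l => //.
case: optO => _ _; apply => //.
by apply/fsubsetP => z /Ts; rewrite !inE.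
Qed.

Lemma objective0 : objective (fset0 : {fset Omega I}) = 0.
Proof. by rewrite /objective imfset0 big_seq_fset0. Qed.

Lemma objective_one_item T x : {in T, forall z, z.1 = x} ->
  objective T <= weight x.
Proof.
move=> Tx; have [->|/fset0Pn[z zT]] := eqVneq T fset0.
  by rewrite objective0 weight_ge0.
rewrite /objective (_ : [fset _ | _ in T] = [fset x]) ?big_seq_fset1 //.
apply/fsetP => y; rewrite !inE; apply/imfsetP/eqP => /= [[t tT ->]|->].
  exact: Tx.
by exists z => //; rewrite Tx.
Qed.

Lemma objective_gt0_neq0 T : 0 < objective T -> T != fset0.
Proof. by apply: contraTneq => ->; rewrite objective0 ltxx. Qed.

Lemma fset1_eq T x : T != fset0 -> T `<=` [fset x] -> T = [fset x].
Proof. by move=> /negPf T0; rewrite fsubset1 T0 orbF => /eqP. Qed.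

Lemma solution_nil A : solution A ([::] : seq (Omega I)) = fset0.
Proof. by apply/fsetP => z; rewrite inE; apply/negP => /imfsetP[[]]. Qed.

End Generalities.

(** * The weight sequence *)

Section HardInstance.
Context {R : realType} (alpha : R).
Hypotheses (alpha_gt0 : 0 < alpha) (alpha_lt4 : alpha < 4).

(** The value [alpha - 1] gives [wt 0 + wt 1 = alpha * wt 0]; the recurrence is the difference of
    consecutive identities [sum_wt]. *)
Fixpoint wt (n : nat) : R :=
  if n is n'.+1 then
    if n' is n''.+1 then alpha * (wt n' - wt n'') else alpha - 1
  else 1.

Arguments wt : simpl never.

Lemma wtSS n : wt n.+2 = alpha * (wt n.+1 - wt n).
Proof. by []. Qed.

Lemma sum_wt n : \sum_(k < n.+2) wt k = alpha * wt n.
Proof.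
elim: n => [|n IHn].
  by rewrite 2!big_ord_recr big_ord0 /= add0r /wt mulr1 subrKC.
by rewrite big_ord_recr /= IHn wtSS; ring.
Qed.

(* If all weights were positive, the ratios [q n = wt n.+1 / wt n] would lie in
   ]0, alpha] and satisfy [q n.+1 = alpha * (1 - (q n)^-1)], hence
   [q n - q n.+1 = ((q n) ^+ 2 - alpha * q n + alpha) / q n >= 1 - alpha / 4]. *)
Lemma wt_le0_ex : exists n, wt n <= 0.
Proof.
apply: contrapT => /forallNP noneg.
have w0 n : 0 < wt n by rewrite ltNge; apply/negP/noneg.
pose c := 1 - alpha / 4; have c0 : 0 < c by rewrite subr_gt0 ltr_pdivrMr ?mul1r.
have decr n : wt n.+1 <= (alpha - n%:R * c) * wt n.
  elim: n => [|n IHn]; first by rewrite mul0r subr0 /wt mulr1 gerBl.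
  rewrite wtSS -natr1.
  have := w0 n; have := w0 n.+1.
  have : wt n.+1 <= alpha * wt n.
    apply: (le_trans IHn); apply: ler_wpM2r; first exact: ltW.
    by rewrite gerBl mulr_ge0 // ltW.
  move: IHn; set x := wt n; set y := wt n.+1.
  set t := _%:R => h1 h2 y0 x0.
  rewrite -(ler_pM2r x0).
  (* The goal amounts to [(t + 1) * c * x * y <= alpha * x ^+ 2]: [h3] bounds the [t] term, [h4] the
     other one, and the slack left is this square. *)
  have sq := sqr_ge0 (y - alpha * x / 2).
  have h3 := ler_wpM2l (ltW y0) h1.
  have h4 : c * x * y <= c * x * (alpha * x).
    by rewrite ler_wpM2l // mulr_ge0 // ltW.
  by move: h3 h4; rewrite /c; lra.
(* From [n > alpha / c] on, the factor [alpha - n * c] is negative. *)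
pose n := (Num.truncn (alpha / c)).+1.
have /lt_le_trans/(_ (decr n)) := w0 n.+1.
rewrite pmulr_lgt0 // subr_gt0 -ltr_pdivlMr // ltNge ltW //.
exact: truncnS_gt.
Qed.

(** * The hard instance and its arrivals *)

Definition hard_weight n : R := Num.max 0 (wt n).

Lemma hard_weight_ge0 n : 0 <= hard_weight n.
Proof. by rewrite le_max lexx. Qed.

Definition hard_instance : instance R := @Instance R nat _ hard_weight_ge0.

Fixpoint arrivals n : seq (Omega hard_instance) :=
  if n is m.+1 then rcons (rcons (arrivals m) (m, 0%N)) (m, m.+1) else [::].

Lemma mem_arrivals n (z : Omega hard_instance) :
  (z \in arrivals n) = (z.1 < n)%N && ((z.2 == 0%N) || (z.2 == z.1.+1)).
Proof.
elim: n => [|n IHn]; first by rewrite ltn0.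
rewrite /= mem_rcons inE mem_rcons inE {}IHn ltnS; case: z => k i /=.
by rewrite !xpair_eqE; case: (ltngtP k n) => [_|_|->]; rewrite /= ?orbF // orbC.
Qed.

Lemma uniq_arrivals n :
  uniq (rcons (arrivals n) (n, 0%N)) /\ uniq (arrivals n).
Proof.
elim: n => [|n [IHn _]] //.
have u : uniq (arrivals n.+1).
  by rewrite /= rcons_uniq IHn andbT mem_rcons inE mem_arrivals xpair_eqE /= ltnn andbF.
by split=> //; rewrite rcons_uniq u mem_arrivals /= ltnn.
Qed.

Lemma objective_matching n (g : nat -> nat) :
  \sum_(k < n) wt k <=
  objective ([fset (k, g k) | k in iota 0 n]%fset : {fset Omega hard_instance}).
Proof.
rewrite /objective (perm_big (iota 0 n)) /=.
  rewrite -(big_mkord xpredT wt) /index_iota subn0.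
  (* Truncation at 0 can only raise a weight. *)
  by apply: ler_sum => k _; rewrite /hard_weight le_max lexx orbT.
apply: uniq_perm => [||k]; rewrite ?fset_uniq ?iota_uniq //.
apply/imfsetP/idP => [[_ /imfsetP[j jn ->] ->] //|kn].
by exists (k, g k) => //; apply/imfsetP; exists k.
Qed.

(** * The forced run of the algorithm *)

Context {A : rule R} {r : R}.
Hypotheses (alg : online_algorithm A) (strict : strictly_monotone A).
Hypotheses (r_gt : alpha^-1 < r) (comp : competitive A r).

Let r_gt0 : 0 < r. Proof. by apply: lt_trans r_gt; rewrite invr_gt0. Qed.

Let ralpha_gt1 : 1 < r * alpha. Proof. by rewrite -ltr_pdivrMr // div1r. Qed.

Lemma solution_ge n (g : nat -> nat) (s : seq (Omega hard_instance)) :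
    uniq s -> {in iota 0 n &, injective g} ->
    (forall k, (k < n)%N -> (k, g k) \in s) ->
  r * \sum_(k < n) wt k <= objective (solution A s).
Proof.
move=> us injg gs; apply: le_trans (ler_wpM2l (ltW r_gt0) (objective_matching n g)) _.
apply: competitive_independent => //; first exact: ltW.
  apply/independentP => _ _ /imfsetP[k kn ->] /imfsetP[l ln ->] /= eq_g.
  by rewrite (injg k l).
by move=> _ /imfsetP[k kn ->]; apply: gs; move: kn; rewrite /= mem_iota.
Qed.

Lemma solution_arrivals_ge n :
  r * \sum_(k < n) wt k <= objective (solution A (arrivals n)).
Proof.
apply: (solution_ge n S); first by case: (uniq_arrivals n).
  by move=> k l _ _ [].
by move=> k kn; rewrite mem_arrivals /= kn eqxx.
Qed.

Lemma solution_rcons_arrivals_ge n :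
  r * \sum_(k < n.+1) wt k <= objective (solution A (rcons (arrivals n) (n, 0%N))).
Proof.
(* Item [n] has only its copy in part 0 so far; earlier items use their private parts. *)
apply: (solution_ge n.+1 (fun k => if k == n then 0%N else k.+1)).
- by case: (uniq_arrivals n).
- by move=> k l _ _ /=; do 2![case: eqVneq => // ?]; [subst|case].
move=> k; rewrite ltnS leq_eqVlt mem_rcons inE.
case: eqVneq => [->|_ /= kn]; first by rewrite eqxx.
by rewrite mem_arrivals /= kn eqxx orbT.
Qed.

Lemma sum_wt_gt0 n : (forall k, (k <= n)%N -> 0 < wt k) ->
  0 < \sum_(k < n.+1) wt k.
Proof.
move=> w_gt0; rewrite big_ord_recr /= ltr_wpDl ?w_gt0 // sumr_ge0 // => k _.
by rewrite ltW // w_gt0 // ltnW.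
Qed.

(** Taking the second copy of item [n] leaves only copies of that item, so the value cannot
    increase; dropping everything would violate the ratio. *)
Lemma reject_copy n : (forall k, (k <= n)%N -> 0 < wt k) ->
  solution A (rcons (arrivals n) (n, 0%N)) = [fset (n, 0%N)]%fset ->
  solution A (arrivals n.+1) = [fset (n, 0%N)]%fset.
Proof.
move=> w_gt0 held; have [_ us] := uniq_arrivals n.+1.
have [_ /(_ _ _ us)] := alg hard_instance; rewrite held -/(arrivals n.+1).
move=> /fsubsetP sub; apply: fset1_eq.
  apply/objective_gt0_neq0/lt_le_trans/solution_arrivals_ge.
  by rewrite mulr_gt0 // sum_wt_gt0.
have notin : (n, n.+1) \notin solution A (arrivals n.+1).
  apply/negP => /(strict _ _ _ us); rewrite held -/(arrivals n.+1) ltNge.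
  rewrite /objective imfset_fset1 big_seq_fset1 => /negP; apply.
  by apply: objective_one_item => z /sub; rewrite !inE => /orP[] /eqP->.
apply/fsubsetP => z zS; have := sub z zS; rewrite !inE => /orP[/eqP zE|//].
by rewrite -zE zS in notin.
Qed.

Lemma held_item n : (forall k, (k <= n)%N -> 0 < wt k) ->
  solution A (arrivals n.+1) = [fset (n, 0%N)]%fset.
Proof.
elim: n => [|n IHn] w_gt0; apply: reject_copy => //.
  have [_ /(_ [::] (0, 0)%N isT)] := alg hard_instance.
  rewrite solution_nil fsetU0 => sub; apply: fset1_eq => //.
  apply/objective_gt0_neq0/lt_le_trans/(solution_rcons_arrivals_ge 0).
  by rewrite mulr_gt0 // sum_wt_gt0.
have {}IHn := IHn (fun k kn => w_gt0 k (leqW kn)).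
set s := rcons _ _; have [us _] := uniq_arrivals n.+1.
have [ind /(_ _ _ us)] := alg hard_instance; rewrite -/s IHn => /fsubsetP sub.
have /independentP inj := ind s us.
have new : (n.+1, 0%N) \in solution A s.
  (* Rejecting item [n.+1] leaves value at most [wt n], below the required [r * alpha * wt n]. *)
  apply/negPn/negP => notin.
  have := solution_rcons_arrivals_ge n.+1; rewrite sum_wt -/s leNgt => /negP; apply.
  have wn := w_gt0 n (leqnSn n).
  apply: (@le_lt_trans _ _ (wt n)); last by rewrite mulrA ltr_pMl.
  rewrite (_ : wt n = @weight _ hard_instance n); last first.
    by rewrite /= /hard_weight max_r // ltW.
  apply: objective_one_item => z zS; have := sub z zS.
  by rewrite !inE => /orP[/eqP zE|/eqP-> //]; rewrite -zE zS in notin.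
apply: fset1_eq; first by apply/fset0Pn; exists (n.+1, 0%N).
(* Both candidates lie in part 0, so the new item evicts item [n]. *)
apply/fsubsetP => z zS; rewrite inE; apply/eqP/inj => //.
by have := sub z zS; rewrite !inE => /orP[] /eqP->.
Qed.

Lemma hard_instance_absurd : False.
Proof.
have [n w_le0 w_min] := ex_minnP wt_le0_ex.
have w_gt0 k : (k < n)%N -> 0 < wt k.
  by move=> kn; rewrite ltNge; apply: contraL kn => /w_min; rewrite -leqNgt.
case: n => [|n] in w_le0 w_min w_gt0 *; first by move: w_le0; rewrite /wt ler10.
have wn := w_gt0 n (leqnn _).
have := solution_arrivals_ge n.+1; rewrite held_item //.
rewrite /objective imfset_fset1 big_seq_fset1 /= /hard_weight max_r; last exact: ltW.
apply/negP; rewrite -ltNge.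
(* As [wt n.+1 <= 0], omitting it from [sum_wt] leaves a sum of at least [alpha * wt n]. *)
apply: (@lt_le_trans _ _ (r * (alpha * wt n))); first by rewrite mulrA ltr_pMl.
rewrite ler_wpM2l ?(ltW r_gt0) // -sum_wt [X in X <= _]big_ord_recr /=.
by rewrite gerDl.
Qed.

End HardInstance.

Theorem theorem6p1 (R : realType) (alpha : R)
    (alpha_gt0 : 0 < alpha) (alpha_lt4 : alpha < 4) :
  ~ exists (A : rule R) (r : R),
      [/\ online_algorithm A, strictly_monotone A, alpha^-1 < r &
          competitive A r].
Proof.
move=> [A [r [alg strict r_gt comp]]].
exact: (hard_instance_absurd _ alpha_gt0 alpha_lt4 alg strict r_gt comp).
Qed.
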